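(* Let $(G_n)$ be a family of connected strongly regular graphs, where $G_n$ has $n$ vertices and $n$ ranges over an infinite set of positive integers, such that for each $n$ the complement $\overline{G_n}$ is not a disjoint union of $m$ copies of a complete graph for any $m>1$. Then \[ \mathcal{K}(G_n)\,\mathcal{K}(\overline{G_n})=\Theta(n^2). \]
   Context: Graphs are finite, simple, undirected and unweighted. $\overline{G}$ is the complement of $G$. A graph on $n$ vertices that is neither complete nor edgeless is strongly regular with parameters $(n,k;a,c)$ if it is $k$-regular, every two adjacent vertices have exactly $a$ common neighbours, and every two distinct non-adjacent vertices have exactly $c$ common neighbours. For a connected graph $G$ with vertex set $\{1,\dots,n\}$, $m$ edges and vertex degrees $d_1,\dots,d_n$, Kemeny's constant is $\mathcal{K}(G)=\sum_{j\neq i}\frac{d_j}{2m}\,m_{i,j}$, where $m_{i,j}$ is the expected first time at which the simple random walk on $G$ (which moves at each step to a uniformly random neighbour) started at $i$ reaches $j$; this value does not depend on the choice of $i$. Asymptotic notation: $f(G_n)=O(g(n))$ means $\limsup_{n\to\infty} f(G_n)/g(n)$ is finite, and $f=\Theta(g)$ means $f=O(g)$ and $g=O(f)$. *)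

(* Defs.v *)
From mathcomp Require Import all_boot all_order all_algebra.
From mathcomp Require Import all_classical all_reals all_analysis.
Set Implicit Arguments.
Unset Strict Implicit.
Unset Printing Implicit Defensive.
Import Order.TTheory GRing.Theory Num.Theory.
Local Open Scope ring_scope.

Record sgraph (T : finType) := SGraph {
  adj :> rel T;
  adj_sym : symmetric adj;
  adj_irr : irreflexive adj }.

Section Graphs.
Variable T : finType.
Implicit Type G : sgraph T.

Definition compl_adj G : rel T := fun x y => (x != y) && ~~ G x y.

Lemma compl_adj_sym G : symmetric (compl_adj G).
Proof. by move=> x y; rewrite /compl_adj eq_sym adj_sym. Qed.

Lemma compl_adj_irr G : irreflexive (compl_adj G).
Proof. by move=> x; rewrite /compl_adj eqxx. Qed.

Definition compl G : sgraph T := SGraph (@compl_adj_sym G) (@compl_adj_irr G).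

Definition degree G (x : T) : nat := #|[set y | G x y]|.

Definition common_nbrs G (x y : T) : nat := #|[set z | G x z & G y z]|.

Definition edges G : {set {set T}} :=
  [set [set p.1; p.2] | p : T * T & G p.1 p.2].

Definition connected_graph G : Prop := forall x y, connect G x y.

Definition complete_graph G : Prop := forall x y, x != y -> G x y.

Definition edgeless G : Prop := forall x y, ~~ G x y.

Definition srg_params G (k a c : nat) : Prop :=
  [/\ ~ complete_graph G, ~ edgeless G,
      forall x, degree G x = k,
      forall x y, G x y -> common_nbrs G x y = a &
      forall x y, x != y -> ~~ G x y -> common_nbrs G x y = c].

Definition strongly_regular G : Prop := exists k a c, srg_params G k a c.

End Graphs.

Definition isomorphic (T U : finType) (G : sgraph T) (H : sgraph U) : Prop :=
  exists2 f : T -> U, bijective f & forall x y, H (f x) (f y) = G x y.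

Section CompleteCopies.
Variables m r : nat.

Definition copies_adj : rel ('I_m * 'I_r)%type :=
  fun p q => (p.1 == q.1) && (p.2 != q.2).

Lemma copies_adj_sym : symmetric copies_adj.
Proof.
by move=> p q; rewrite /copies_adj (eq_sym p.1) (eq_sym p.2).
Qed.

Lemma copies_adj_irr : irreflexive copies_adj.
Proof. by move=> p; rewrite /copies_adj !eqxx. Qed.

(* m K_r *)
Definition complete_copies : sgraph ('I_m * 'I_r)%type :=
  SGraph copies_adj_sym copies_adj_irr.

End CompleteCopies.

Section Kemeny.
Variables (R : realType) (T : finType) (G : sgraph T).

(* At an isolated vertex no move is possible, and the row of x is zero. *)
Definition step_prob (x y : T) : R :=
  if G x y then (degree G x)%:R^-1 else 0.

(* P_i(tau_j = t), where tau_j is the first time the walk is at j: the sum,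
   over all trajectories i = x_0, x_1, ..., x_t = j with x_s <> j for s < t,
   of the probability of the trajectory.  Here w = x_1 ... x_t, and
   belast i w = x_0 ... x_(t-1). *)
Definition first_hit_prob (i j : T) (t : nat) : R :=
  \sum_(w : t.-tuple T | (last i w == j) && (j \notin belast i w))
    \prod_(s < t) step_prob (nth i (i :: w) s) (nth i w s).

(* The expectation of tau_j in [0, +oo], the value +oo being taken with
   probability 1 - sum_t P_i(tau_j = t); recall that +oo * 0 = 0. *)
Definition mean_hitting_time (i j : T) : \bar R :=
  (\sum_(0 <= t <oo) (t%:R * first_hit_prob i j t)%:E
   + +oo * (1 - \sum_(0 <= t <oo) (first_hit_prob i j t)%:E))%E.

Definition kemeny_from (i : T) : \bar R :=
  (\sum_(j | j != i)
     ((degree G j)%:R / (2 * #|edges G|)%:R)%:E * mean_hitting_time i j)%E.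

(* For connected G, kemeny_from i does not depend on i, so that any starting
   vertex may be taken; the value is +oo when j is unreachable from i for
   some j that is not isolated.  Without vertices the value is 0. *)
Definition kemeny : \bar R :=
  if [pick i : T] is Some i then kemeny_from i else 0%E.

End Kemeny.

Section Asymptotics.
Variable R : realType.

(* n tends to infinity within S.  The quotient is that of the extended
   reals, where 0^-1 = +oo: a vanishing g is not ignored. *)
Definition bigO_along (S : set nat) (f g : nat -> \bar R) : Prop :=
  limf_esup (fun n => f n / g n)%E (within S \oo%classic) \is a fin_num.

Definition bigTheta_along (S : set nat) (f g : nat -> \bar R) : Prop :=
  bigO_along S f g /\ bigO_along S g f.

End Asymptotics.

(* Main.v *)
Require Import Defs.
From mathcomp Require Import all_boot all_order all_algebra.
From mathcomp Require Import all_classical all_reals all_analysis.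
From mathcomp Require Import ring lra zify.
Set Implicit Arguments.
Unset Strict Implicit.
Unset Printing Implicit Defensive.
Import Order.TTheory GRing.Theory Num.Theory numFieldNormedType.Exports.
Local Open Scope classical_set_scope.
Local Open Scope ring_scope.

(** For a strongly regular graph [G] on [n] vertices with degree [k] and with
    [c > 0] common neighbours of distinct non-adjacent vertices, Kemeny's
    constant has the closed form
      K(G) = ((n - 1)^2 + k (n - 1 - k) / c) / n,
    see [srg_kemeny].  The reason is that the mean hitting time of [j] from [i]
    depends only on whether [i] and [j] are adjacent, so that the equations
    h i = 1 + sum over x of P(i, x) h x for the hitting times reduce to two
    linear equations; they give [n - 1] for adjacent vertices and
    [n - 1 + k / c] for non-adjacent ones.  Since [c] is at least 1 and both
    [k] and [n - 1 - k] are at most [n], the second term of the numerator is at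
    most [n^2], and K(G) lies between [n / 4] and [2 n]
    ([srg_kemeny_bounds]).

    The same bounds hold for the complement, which is strongly regular
    ([srg_compl]), as soon as its own parameter [c] is positive.  If [c = 0],
    adjacency is transitive on distinct vertices ([srg_adj_trans]).  A connected
    graph would then be complete, which settles [G]; in the complement the
    closed neighbourhoods would be cliques of equal size partitioning the
    vertices, which is the excluded disjoint union of complete graphs
    ([disjoint_cliques]).  Multiplying the bounds gives
    n^2 / 16 <= K(G) K(compl G) <= 4 n^2.

    The hitting times are defined by series over trajectories, and
    [mean_hitting_timeE] identifies them with the nonnegative solution of the
    linear equations.  With S_t the probability that [j] is not reached by time
    [t], the partial sums of the expectation are
      h - (h - sum of S_u for u < t) - t S_t,
    and both corrections vanish because the difference in parentheses is at
    least S_t and decays geometrically. *)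

(** * Sums and series *)

Lemma big_tuple_cons (V : nmodType) (T : finType) (t : nat)
    (P : pred (t.+1.-tuple T)) (F : t.+1.-tuple T -> V) :
  \sum_(w | P w) F w =
  \sum_x \sum_(w : t.-tuple T | P (cons_tuple x w)) F (cons_tuple x w).
Proof.
rewrite pair_big_dep /= (reindex (fun p : T * t.-tuple T => cons_tuple p.1 p.2)).
  by [].
exists (fun w : t.+1.-tuple T => (thead w, [tuple of behead w])).
  by move=> [x w] _ /=; congr pair; apply/val_inj.
by move=> w _; rewrite [RHS]tuple_eta; apply/val_inj.
Qed.

(** For [p] the law of a waiting time, this expresses the truncated expectation
    by the tail probabilities. *)
Lemma telescoping_sum_by_parts (R : comNzRingType) (p : R ^nat) (t : nat) :
  \sum_(0 <= u < t.+1) u%:R * p u =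
  \sum_(0 <= u < t) (1 - \sum_(0 <= v < u.+1) p v)
  - t%:R * (1 - \sum_(0 <= v < t.+1) p v).
Proof.
elim: t => [|t IHt]; first by rewrite big_nat1 big_geq // !mul0r subr0.
rewrite big_nat_recr //= IHt [in RHS]big_nat_recr //=.
rewrite [in X in _ = _ - _ * (1 - X)]big_nat_recr //= -natr1.
set s := \sum_(0 <= v < t.+1) p v; set S := \sum_(0 <= i < t) _.
ring.
Qed.

(** The geometric rate is relaxed from [r] to the midpoint of [r] and 1 so that
    the extra growth absorbs the factor [t]; the constant is the one for which
    the induction step closes. *)
Lemma mulrn_expr_le (R : realFieldType) (r : R) (t : nat) :
  0 <= r -> r < 1 -> t%:R * r ^+ t <= 2 / (1 - r) * ((1 + r) / 2) ^+ t.
Proof.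
move=> r0 r1; have d0 : 0 < 1 - r by rewrite subr_gt0.
elim: t => [|t IHt].
  by rewrite mul0r expr0 mulr1 divr_ge0 // ltW.
have rs : r ^+ t <= ((1 + r) / 2) ^+ t by apply: lerXn2r; rewrite ?nnegrE; lra.
have rt0 : 0 <= r ^+ t by rewrite exprn_ge0.
rewrite -natr1 !exprS mulrDl mul1r.
have -> : 2 / (1 - r) * ((1 + r) / 2 * ((1 + r) / 2) ^+ t) =
  r * (2 / (1 - r) * ((1 + r) / 2) ^+ t) + ((1 + r) / 2) ^+ t.
  by field; rewrite lt0r_neq0.
apply: lerD; first by rewrite mulrCA ler_wpM2l.
by apply: le_trans rs; rewrite ler_piMl // ltW.
Qed.

Lemma eseries_EFin (R : realType) (u : R ^nat) (l : R) :
  (\sum_(0 <= t < n.+1) u t) @[n --> \oo] --> l ->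
  (\sum_(0 <= t <oo) (u t)%:E)%E = l%:E.
Proof.
move=> ul; apply/cvg_lim => //; rewrite -cvg_shiftS /=.
under eq_cvg do rewrite sumEFin.
by apply: cvg_EFin => //; near=> n.
Unshelve. all: by end_near. Qed.

(** * Hitting times from the one-step equations *)

Section HittingTime.
Variables (R : realType) (T : finType) (G : sgraph T).
Implicit Types i j x : T.

Notation P := (step_prob R G).

Lemma step_prob_ge0 x y : 0 <= P x y.
Proof. by rewrite /step_prob; case: ifP => // _; rewrite invr_ge0 ler0n. Qed.

Lemma sum_step_prob x (f : T -> R) :
  \sum_y P x y * f y = (degree G x)%:R^-1 * \sum_(y | G x y) f y.
Proof.
rewrite mulr_sumr [RHS]big_mkcond; apply: eq_bigr => y _.
by rewrite /step_prob; case: ifP; rewrite ?mul0r.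
Qed.

Lemma sum_step_prob1 x : (0 < degree G x)%N -> \sum_y P x y = 1.
Proof.
move=> d0; under eq_bigr do rewrite -[P _ _]mulr1.
rewrite sum_step_prob sumr_const.
have -> : #|[pred y | G x y]| = degree G x.
  by rewrite /degree; apply: eq_card => y; rewrite !inE.
by rewrite mulVf // pnatr_eq0 -lt0n.
Qed.

Lemma first_hit_prob0 i j : first_hit_prob R G i j 0 = (i == j)%:R.
Proof.
rewrite /first_hit_prob (eq_bigl (fun w => i == j)); last first.
  by move=> w; rewrite (tuple0 w) /= andbT.
case: eqVneq => _; last by rewrite big_pred0.
rewrite (big_pred1 [tuple]) ?big_ord0 // => w.
by rewrite [w]tuple0 /= eqxx.
Qed.

(** First-step decomposition: a trajectory of length [t + 1] is its first step
    followed by a trajectory of length [t], and the walk must not start at [j]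
    since it would have hit [j] at time 0. *)
Lemma first_hit_probS i j t :
  first_hit_prob R G i j t.+1 =
  if i == j then 0 else \sum_x P i x * first_hit_prob R G x j t.
Proof.
rewrite /first_hit_prob big_tuple_cons; case: eqVneq => [<-|ij].
  by apply: big1 => x _; apply: big_pred0 => w /=; rewrite mem_head andbF.
apply: eq_bigr => x _; rewrite mulr_sumr; apply: eq_big => [w /=|w _].
  by rewrite inE (eq_sym j) (negPf ij).
rewrite big_ord_recl /=; congr (_ * _); apply: eq_bigr => s _.
rewrite /= add0n.
by congr step_prob; apply: set_nth_default; have := ltn_ord s; rewrite /= size_tuple; lia.
Qed.

Section Poisson.
Variables (j : T) (h : T -> R).
Hypothesis deg_gt0 : forall i, i != j -> (0 < degree G i)%N.
Hypothesis h_ge0 : forall i, 0 <= h i.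
Hypothesis h_j : h j = 0.
Hypothesis h_step : forall i, i != j -> h i = 1 + \sum_x P i x * h x.

(** The probability that [j] is not reached from [i] up to time [t]. *)
Let survival t i : R := 1 - \sum_(0 <= u < t.+1) first_hit_prob R G i j u.

Let survival0 i : survival 0 i = (i != j)%:R.
Proof.
by rewrite /survival big_nat1 first_hit_prob0; case: eqP; rewrite ?subrr ?subr0.
Qed.

Let survival_j t : survival t j = 0.
Proof.
rewrite /survival big_nat_recl // first_hit_prob0 eqxx big1 ?addr0 ?subrr //.
by move=> u _; rewrite first_hit_probS eqxx.
Qed.

Let survivalS t i : i != j -> survival t.+1 i = \sum_x P i x * survival t x.
Proof.
move=> ij; rewrite /survival big_nat_recl // first_hit_prob0 (negPf ij) add0r.
under eq_bigr do rewrite first_hit_probS (negPf ij).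
rewrite exchange_big /= -[X in X - _](sum_step_prob1 (deg_gt0 ij)) -sumrB.
by apply: eq_bigr => x _; rewrite mulrBr mulr1 mulr_sumr.
Qed.

(** The part of [h i] due to the times after [t]: the expectation of [h] at the
    position of the walk at time [t], killed when it reaches [j]. *)
Let deficit t i : R := h i - \sum_(0 <= u < t) survival u i.

Let deficit_j t : deficit t j = 0.
Proof. by rewrite /deficit h_j big1 ?subrr // => u _; rewrite survival_j. Qed.

Let deficitS t i : i != j -> deficit t.+1 i = \sum_x P i x * deficit t x.
Proof.
move=> ij; rewrite /deficit big_nat_recl // survival0 ij h_step //.
under eq_bigr do rewrite survivalS //.
rewrite exchange_big /= opprD addrACA subrr add0r -sumrB.
by apply: eq_bigr => x _; rewrite mulrBr mulr_sumr.
Qed.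

(** Both quantities obey the same linear recursion, with initial values
    [i != j] and [h i], and [h] is at least 1 away from [j]. *)
Let survival_bounds t i : 0 <= survival t i <= deficit t i.
Proof.
elim: t i => [|t IHt] i.
  rewrite survival0 /deficit big_geq // subr0; case: eqVneq => [_|ij].
    by rewrite lexx h_ge0.
  rewrite ler01 h_step //= lerDl sumr_ge0 // => x _.
  by rewrite mulr_ge0 ?step_prob_ge0 ?h_ge0.
have [->|ij] := eqVneq i j; first by rewrite survival_j deficit_j lexx.
rewrite survivalS // deficitS //; apply/andP; split.
  by apply: sumr_ge0 => x _; case/andP: (IHt x) => *; rewrite mulr_ge0 ?step_prob_ge0.
by apply: ler_sum => x _; case/andP: (IHt x) => *; rewrite ler_wpM2l ?step_prob_ge0.
Qed.

Let bound : R := 1 + \sum_x h x.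
Let rate : R := 1 - bound^-1.

Let h_le_bound i : h i <= bound.
Proof.
by rewrite /bound (bigD1 i) //= addrCA lerDl addr_ge0 ?ler01 // sumr_ge0.
Qed.

Let bound_ge1 : 1 <= bound.
Proof. by rewrite lerDl sumr_ge0. Qed.

Let rate_ge0 : 0 <= rate.
Proof. by rewrite subr_ge0 invf_le1 ?bound_ge1 // (lt_le_trans ltr01). Qed.

Let rate_lt1 : rate < 1.
Proof. by rewrite ltrBlDr ltrDl invr_gt0 (lt_le_trans ltr01). Qed.

(** Away from [j], one step maps [h] to [h - 1], and [h - 1 <= rate * h] because
    [h <= bound]. *)
Let deficit_decay t i : deficit t i <= rate ^+ t * h i.
Proof.
elim: t i => [|t IHt] i; first by rewrite /deficit big_geq // subr0 mul1r.
have [->|ij] := eqVneq i j; first by rewrite deficit_j h_j mulr0.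
rewrite deficitS //.
apply: (@le_trans _ _ (\sum_x P i x * (rate ^+ t * h x))).
  by apply: ler_sum => x _; rewrite ler_wpM2l ?step_prob_ge0.
under eq_bigr do rewrite mulrCA.
rewrite -mulr_sumr exprSr -mulrA ler_wpM2l ?exprn_ge0 //.
have -> : \sum_x P i x * h x = h i - 1 by rewrite [in RHS]h_step // addrC addKr.
rewrite /rate mulrBl mul1r lerB // mulrC ler_pdivrMr ?mul1r //.
by rewrite (lt_le_trans ltr01).
Qed.

Let deficit_cvg i : deficit t i @[t --> \oo] --> 0.
Proof.
apply: (@squeeze_cvgr _ _ _ _ (fun=> 0) (geometric (h i) rate)).
- near=> t; case/andP: (survival_bounds t i) => s0 sd.
  by rewrite (le_trans s0 sd) /= mulrC deficit_decay.
- exact: cvg_cst.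
- by apply: cvg_geometric; rewrite ger0_norm.
Unshelve. all: by end_near. Qed.

Let survival_cvg i : survival t i @[t --> \oo] --> 0.
Proof.
apply: (@squeeze_cvgr _ _ _ _ (fun=> 0) (deficit ^~ i)).
- by near=> t; apply: survival_bounds.
- exact: cvg_cst.
- exact: deficit_cvg.
Unshelve. all: by end_near. Qed.

Let mul_survival_cvg i : t%:R * survival t i @[t --> \oo] --> 0.
Proof.
apply: (@squeeze_cvgr _ _ _ _ (fun=> 0)
  (geometric (2 / (1 - rate) * h i) ((1 + rate) / 2))).
- near=> t; case/andP: (survival_bounds t i) => s0 sd.
  rewrite mulr_ge0 //=.
  apply: (@le_trans _ _ (t%:R * (rate ^+ t * h i))).
    by rewrite ler_wpM2l // (le_trans sd) ?deficit_decay.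
  by rewrite mulrA [leRHS]mulrAC ler_wpM2r // mulrn_expr_le.
- exact: cvg_cst.
- apply: cvg_geometric; rewrite ger0_norm; have := rate_ge0; have := rate_lt1; lra.
Unshelve. all: by end_near. Qed.

(** Since [survival] tends to 0, the walk reaches [j] almost surely, so the
    infinite term of the mean hitting time has coefficient 0; the series that
    remains has partial sums [h i - deficit t i - t * survival t i]. *)
Lemma mean_hitting_timeE i : mean_hitting_time R G i j = (h i)%:E.
Proof.
have prob t : \sum_(0 <= u < t.+1) first_hit_prob R G i j u = 1 - survival t i.
  by rewrite /survival opprB addrCA subrr addr0.
have total : (\sum_(0 <= t <oo) (first_hit_prob R G i j t)%:E)%E = 1%E.
  apply: eseries_EFin; under eq_cvg do rewrite prob.
  have := cvgB (cvg_cst (1 : R)) (@survival_cvg i).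
  by rewrite subr0; exact.
have mean : (\sum_(0 <= t <oo) (t%:R * first_hit_prob R G i j t)%:E)%E = (h i)%:E.
  apply: eseries_EFin.
  have partial t : \sum_(0 <= u < t.+1) u%:R * first_hit_prob R G i j u =
      h i - deficit t i - t%:R * survival t i.
    rewrite telescoping_sum_by_parts -/(survival t i) /deficit.
    by rewrite opprB addrCA subrr addr0.
  under eq_cvg do rewrite partial.
  have := cvgB (cvgB (cvg_cst (h i)) (@deficit_cvg i)) (@mul_survival_cvg i).
  by rewrite !subr0; exact.
by rewrite /mean_hitting_time total mean subee // mule0 adde0.
Qed.

End Poisson.
End HittingTime.

(** * Counting in graphs *)

Lemma degreeE (T : finType) (G : sgraph T) x : degree G x = (\sum_y G x y)%N.
Proof. by rewrite /degree cardsE -sum1_card big_mkcond; apply: eq_bigr. Qed.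

Section Counting.
Variables (T : finType) (G : sgraph T).
Implicit Types x y z : T.

Lemma common_nbrsE x y : common_nbrs G x y = (\sum_z (G x z && G y z))%N.
Proof. by rewrite /common_nbrs cardsE -sum1_card big_mkcond; apply: eq_bigr. Qed.

Lemma common_nbrsxx x : common_nbrs G x x = degree G x.
Proof. by rewrite common_nbrsE degreeE; apply: eq_bigr => z _; rewrite andbb. Qed.

Lemma adj_neq x y : G x y -> x != y.
Proof. by apply: contraTneq => ->; rewrite adj_irr. Qed.

Lemma adj_trichotomy x y : ((x == y) + G x y + compl G x y = 1)%N.
Proof. by rewrite /= /compl_adj; case: eqVneq => [->|_]; rewrite ?adj_irr; case: (G x y). Qed.

Lemma degree_compl x : (1 + degree G x + degree (compl G) x = #|T|)%N.
Proof.
have -> : 1%N = (\sum_y (x == y))%N.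
  rewrite (bigD1 x) //= eqxx big1 // => y /negPf; by rewrite eq_sym => ->.
rewrite !degreeE -!big_split /= -sum1_card.
by apply: eq_big => // y _; apply: adj_trichotomy.
Qed.

(** Both sides count the walks of length 2 starting at [x]. *)
Lemma sum_common_nbrs x :
  (\sum_y common_nbrs G x y = \sum_(z | G x z) degree G z)%N.
Proof.
under eq_bigr do rewrite common_nbrsE.
rewrite exchange_big [RHS]big_mkcond; apply: eq_bigr => z _ /=.
case: (G x z) => /=; last by rewrite big1.
by rewrite degreeE; apply: eq_bigr => y _; rewrite adj_sym.
Qed.

(** Each edge is the image of exactly two ordered pairs of adjacent vertices. *)
Lemma sum_degree : (\sum_x degree G x = 2 * #|edges G|)%N.
Proof.
under eq_bigr do rewrite degreeE.
rewrite pair_big /= -big_mkcond sum1_card /=.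
rewrite -sum1_card.
rewrite (partition_big_imset (fun p : T * T => [set p.1; p.2]%SET)) /=.
rewrite mulnC -sum_nat_const; apply: eq_big => [e|e /imsetP[[x y]]].
  by apply/imsetP/imsetP => -[p pG ->]; exists p; move: pG; rewrite ?inE.
move=> Gxy ->; have xy : G x y := Gxy.
have xNy := adj_neq xy.
rewrite sum1_card (eq_card (B := [set (x, y); (y, x)]%SET)).
  by rewrite cards2 xpair_eqE negb_and xNy.
move=> [u v]; rewrite !inE !xpair_eqE; apply/andP/idP => [[uv /eqP e1]|].
  have : u \in [set x; y]%SET by rewrite -e1 set21.
  have : v \in [set x; y]%SET by rewrite -e1 set22.
  have {}uv : G u v := uv.
  rewrite !inE => /pred2P[] ev /pred2P[] eu; move: uv; rewrite ev eu ?adj_irr //.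
    by rewrite !eqxx orbT.
  by rewrite !eqxx.
case/orP=> /andP[/eqP-> /eqP->]; first by [].
by split; [rewrite unfold_in /= adj_sym | rewrite finset.setUC].
Qed.

End Counting.

(** * Strongly regular graphs and their complements *)

Section StronglyRegular.
Variables (T : finType) (G : sgraph T) (k a c : nat).
Hypothesis srg : srg_params G k a c.
Implicit Types x y z : T.

Lemma srg_degree_gt0 : (0 < k)%N.
Proof.
case: srg => _ nedge deg _ _; rewrite lt0n; apply/eqP => k0; apply: nedge => x y.
have /eqP := deg x; rewrite k0 cards_eq0 => /eqP/setP/(_ y).
by rewrite !inE => ->.
Qed.

Lemma srg_not_complete : exists x y, (x != y) && ~~ G x y.
Proof.
case: srg => ncomp _ _ _ _.
have [/existsP[x /existsP[y xy]]|none] :=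
  boolP [exists x, exists y, (x != y) && ~~ G x y]; first by exists x, y.
case: ncomp => x y xy; apply: contraNT none => nxy.
by apply/existsP; exists x; apply/existsP; exists y; rewrite xy.
Qed.

Lemma srg_order_gt1 : (1 < #|T|)%N.
Proof.
have [x [y /andP[xy _]]] := srg_not_complete.
by rewrite (cardD1 x) inE (cardD1 y) !inE eq_sym xy.
Qed.

Lemma srg_common_nbrs x y :
  common_nbrs G x y = ((x == y) * k + G x y * a + compl G x y * c)%N.
Proof.
case: srg => _ _ deg adjE nadjE; rewrite /= /compl_adj.
case: eqVneq => [->|xy] /=; first by rewrite common_nbrsxx deg adj_irr; lia.
by case: (boolP (G x y)) => ? /=; [rewrite adjE|rewrite nadjE] => //; lia.
Qed.

(** The classical relation k (k - a - 1) = (n - k - 1) c, written without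
    subtraction: the walks of length 2 from [x] are sorted by their endpoint. *)
Lemma srg_param_eq x : (k * k = k + k * a + degree (compl G) x * c)%N.
Proof.
case: srg => _ _ deg _ _; have := sum_common_nbrs G x.
under eq_bigr do rewrite srg_common_nbrs.
under [in RHS]eq_bigr do rewrite deg.
rewrite sum_nat_const -[#|_|]cardsE -/(degree G x) deg => <-.
rewrite !big_split -!big_distrl -!degreeE deg /=; congr (_ + _ + _)%N.
by rewrite (bigD1 x) //= eqxx big1 ?addn0 ?mul1n // => y /negPf; rewrite eq_sym => ->.
Qed.

Lemma srg_adj_trans : c = 0%N -> forall x y z, G x y -> G y z -> x != z -> G x z.
Proof.
case: srg => _ _ _ _ nadjE c0 x y z xy yz xz; apply: contraT => nxz.
have /eqP := nadjE x z xz nxz; rewrite c0 cards_eq0 => /eqP/setP/(_ y).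
by rewrite !inE xy adj_sym yz.
Qed.

Lemma srg_connected_gt0 : connected_graph G -> (0 < c)%N.
Proof.
move=> conn; rewrite lt0n; apply/eqP => c0.
have [x [y /andP[xy /negP nxy]]] := srg_not_complete; case: nxy.
suff reach p u : path G u p -> (u == last u p) || G u (last u p).
  by case/connectP: (conn x y) => p /reach + yE; rewrite -yE (negPf xy).
elim: p u => [|v p IHp] u /=; first by rewrite eqxx.
case/andP=> uv /IHp/orP[/eqP <-|vl]; first by rewrite uv orbT.
by case: eqVneq => //= ul; apply: srg_adj_trans c0 _ _ _ uv vl ul.
Qed.

(** Common neighbours of [x] and [y] in the complement are the vertices outside
    both closed neighbourhoods, so inclusion-exclusion expresses their number
    by the common neighbours in [G]. *)
Lemma srg_compl : srg_params (compl G)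
  (#|T| - k.+1) (#|T| - (2 * k.+1 - c)) (#|T| - (2 * k.+1 - (a + 2))).
Proof.
case: srg => ncomp nedge deg adjE nadjE.
have degC x : degree (compl G) x = (#|T| - k.+1)%N.
  by have := degree_compl G x; rewrite deg => <-; lia.
have commC x y : x != y -> common_nbrs (compl G) x y =
    (#|T| - (2 * k.+1 - (common_nbrs G x y + 2 * G x y)))%N.
  move=> xy.
  (* closed neighbourhoods *)
  pose N u : {set T} := (u |: [set v | G u v])%SET.
  have cardN u : #|N u| = k.+1 by rewrite cardsU1 inE adj_irr -(deg u).
  have -> : common_nbrs (compl G) x y = #|~: (N x :|: N y)%SET|.
    apply: eq_card => z; rewrite !inE /compl_adj !negb_or.
    by rewrite (eq_sym z x) (eq_sym z y).
  have cardI : #|N x :&: N y| = (common_nbrs G x y + 2 * G x y)%N.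
    case: (boolP (G x y)) => Gxy; last first.
      rewrite addn0; apply: eq_card => z; rewrite !inE.
      case: (eqVneq z x) => [->|zx] /=.
        by rewrite (negPf xy) adj_irr adj_sym (negPf Gxy).
      case: (eqVneq z y) => [->|zy] //=.
      by rewrite adj_irr (negPf Gxy).
    have -> : (N x :&: N y = x |: (y |: [set z | G x z & G y z]))%SET.
      apply/setP => z; rewrite !inE.
      case: (eqVneq z x) => [->|zx] /=; first by rewrite adj_sym Gxy orbT.
      by case: (eqVneq z y) => [->|zy] //=; rewrite Gxy.
    rewrite !cardsU1 !inE (negPf xy) !adj_irr /= /common_nbrs; lia.
  have := cardsC (N x :|: N y)%SET; rewrite cardsU !cardN cardI; lia.
split=> //.
- by move=> full; apply: nedge => x y; apply/negP => Gxy;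
    have := full x y (adj_neq Gxy); rewrite /= /compl_adj Gxy andbF.
- by move=> empty; apply: ncomp => x y xy;
    have := empty x y; rewrite /= /compl_adj xy negbK.
- move=> x y /andP[xy nxy]; rewrite commC // nadjE // (negPf nxy); congr subn; lia.
- move=> x y xy; rewrite /= /compl_adj xy negbK => Gxy.
  by rewrite commC // adjE // Gxy.
Qed.

End StronglyRegular.

(** Being equal or adjacent is an equivalence relation, whose classes are the
    closed neighbourhoods [N u]; they all have [k + 1] elements.  A vertex is
    sent to the rank of its class among the classes and to its position in the
    enumeration of that class. *)
Lemma disjoint_cliques (T : finType) (G : sgraph T) (k : nat) :
  (forall x, degree G x = k) ->
  (forall x y z, G x y -> G y z -> x != z -> G x z) ->
  ~ complete_graph G ->
  exists2 m : nat, (1 < m)%N & isomorphic G (complete_copies m k.+1).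
Proof.
move=> deg trans ncomp.
have [x0 [y0 [xy0 nxy0]]] : exists x y, x != y /\ ~~ G x y.
  have [//|none] := pselect (exists x y, x != y /\ ~~ G x y).
  by case: ncomp => x y xy; apply: contraPT none => nxy; apply; exists x, y.
pose N u : {set T} := (u |: [set v | G u v])%SET.
have cardN u : #|N u| = k.+1 by rewrite cardsU1 inE adj_irr -(deg u).
have NE u v : (v \in N u) = (u == v) || G u v by rewrite !inE eq_sym.
have eqN u v : (N u == N v) = (u == v) || G u v.
  apply/eqP/idP => [Nuv|]; first by rewrite -NE Nuv NE eqxx.
  case: eqVneq => [->//|uv /= Guv]; apply/setP => z; rewrite !NE.
  apply/orP/orP => -[/eqP <-|Gz].
  - by right; rewrite adj_sym.
  - by have [->|vz] := eqVneq v z; [left|right; apply: trans Gz vz; rewrite adj_sym].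
  - by right.
  - by have [->|uz] := eqVneq u z; [left|right; apply: trans Guv Gz uz].
pose P := [set N u | u : T]%SET.
have NP u : N u \in P by apply: imset_f.
have cardT : #|T| = (#|P| * k.+1)%N.
  rewrite -cardsT; apply: card_uniform_partition.
    by move=> _ /imsetP[u _ ->].
  apply/and3P; split.
  - rewrite finset.eqEsubset finset.subsetT; apply/fintype.subsetP => u _.
    by apply/bigcupP; exists (N u); rewrite ?NE ?eqxx.
  - apply/finset.trivIsetP => _ _ /imsetP[u _ ->] /imsetP[v _ ->]; apply: contraNT.
    rewrite -finset.setI_eq0 => /finset.set0Pn[z]; rewrite inE !NE -!eqN => /andP[/eqP-> /eqP->].
    exact: eqxx.
  - by apply/imsetP => -[u _ /setP/(_ u)]; rewrite inE NE eqxx.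
exists #|P|.
  rewrite (cardsD1 (N x0)) NP (cardsD1 (N y0)) !inE NP andbT eq_sym eqN.
  by rewrite (negPf xy0) (negPf nxy0).
pose f u : 'I_#|P| * 'I_k.+1 :=
  (enum_rank_in (NP x0) (N u), inord (index u (enum (N u)))).
have idx u : (index u (enum (N u)) < k.+1)%N.
  by rewrite -(cardN u) cardE index_mem mem_enum NE eqxx.
have f1 u v : ((f u).1 == (f v).1) = (u == v) || G u v.
  rewrite -eqN; apply/eqP/eqP => [|Nuv]; last by rewrite /f /= Nuv.
  by apply: enum_rank_in_inj; apply: NP.
have f2 u v : (u == v) || G u v -> ((f u).2 == (f v).2) = (u == v).
  rewrite -eqN => /eqP Nuv; apply/eqP/eqP => [|->//] /(congr1 val) /=.
  rewrite !inordK // -Nuv => iuv.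
  have uN : u \in enum (N u) by rewrite mem_enum NE eqxx.
  have vN : v \in enum (N u) by rewrite Nuv mem_enum NE eqxx.
  by rewrite -(nth_index u uN) iuv nth_index.
exists f.
  (* an injection between finite types of the same cardinality *)
  apply: inj_card_bij; last by rewrite card_prod !card_ord cardT.
  move=> u v fuv; apply/eqP; rewrite -f2; first by rewrite fuv.
  by rewrite -f1 fuv.
move=> u v; rewrite /= /copies_adj f1.
case: (boolP ((u == v) || G u v)) => [uv|]; last by rewrite negb_or => /andP[_ /negPf].
by rewrite f2 //=; case: eqVneq uv => //= ->; rewrite adj_irr.
Qed.

(** * Kemeny's constant of a strongly regular graph *)

Section StronglyRegularKemeny.
Variables (R : realType) (T : finType) (G : sgraph T) (k a c : nat).
Hypothesis srg : srg_params G k a c.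
Hypothesis c_gt0 : (0 < c)%N.
Implicit Types i j x : T.

Let n : R := #|T|%:R.
Let kR : R := k%:R.
Let cR : R := c%:R.

Let deg x : degree G x = k. Proof. by case: srg. Qed.

Let n_gt0 : 0 < n.
Proof. by rewrite ltr0n (leq_trans _ (srg_order_gt1 srg)). Qed.

Let kR_gt0 : 0 < kR. Proof. by rewrite ltr0n (srg_degree_gt0 srg). Qed.

Let cR_gt0 : 0 < cR. Proof. by rewrite ltr0n. Qed.

Let degree_complR x : (degree (compl G) x)%:R = n - 1 - kR.
Proof. by rewrite /n -(degree_compl G x) deg !natrD; lra. Qed.

Let param_eq : kR * (kR - 1 - a%:R) = (n - 1 - kR) * cR.
Proof.
have [x _] := srg_not_complete srg.
rewrite -(degree_complR x) mulrDr mulrBr mulr1 /kR /cR -!natrM.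
by rewrite (srg_param_eq srg x) !natrD !natrM; lra.
Qed.

(** The solution of the two equations
      h1 = 1 + (a h1 + (k - 1 - a) h2) / k  and
      h2 = 1 + (c h1 + (k - c) h2) / k
    for the hitting time from an adjacent and from a non-adjacent vertex: the
    second gives h2 = h1 + k / c, and [param_eq] turns the first into
    h1 = n - 1. *)
Definition srg_hitting_time i j : R :=
  (n - 1) * (i != j)%:R + kR / cR * (compl G i j)%:R.

Lemma sum_srg_hitting_time i j :
  \sum_(x | G i x) srg_hitting_time x j =
  (n - 1) * (kR - (G i j)%:R)
  + kR / cR * (kR - (G i j)%:R - (common_nbrs G i j)%:R).
Proof.
have sum_adj : \sum_(x | G i x) 1 = kR.
  by rewrite sumr_const -cardsE /kR -(deg i).
have sum_eq : \sum_(x | G i x) (x == j)%:R = (G i j)%:R :> R.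
  rewrite big_mkcond (bigD1 j) //= eqxx big1 ?addr0; first by case: (G i j).
  by move=> x /negPf ->; case: ifP.
have sum_common : \sum_(x | G i x) (G x j)%:R = (common_nbrs G i j)%:R :> R.
  rewrite common_nbrsE natr_sum big_mkcond; apply: eq_bigr => x _.
  by rewrite (adj_sym G j); case: (G i x).
rewrite big_split -!mulr_sumr /=; congr (_ * _ + _ * _).
  rewrite -sum_adj -sum_eq -sumrB; apply: eq_bigr => x _.
  by case: eqP => _ /=; rewrite ?subrr ?subr0.
rewrite -sum_adj -sum_eq -sum_common -!sumrB; apply: eq_bigr => x _.
have : (x == j)%:R + (G x j)%:R + (compl_adj G x j)%:R = 1 :> R.
  by rewrite -!natrD (adj_trichotomy G x j).
by move=> /=; lra.
Qed.

Lemma srg_mean_hitting_time i j :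
  mean_hitting_time R G i j = (srg_hitting_time i j)%:E.
Proof.
apply: (mean_hitting_timeE (h := srg_hitting_time ^~ j)) => [x _|x||x xj].
- by rewrite deg (srg_degree_gt0 srg).
- have := srg_order_gt1 srg; rewrite -(ler_nat R) -/n => n2.
  have n1 : 0 <= n - 1 by lra.
  by rewrite addr_ge0 // mulr_ge0 // divr_ge0 // ltW.
- by rewrite /srg_hitting_time eqxx /= /compl_adj eqxx !mulr0 addr0.
rewrite sum_step_prob sum_srg_hitting_time deg (srg_common_nbrs srg).
rewrite /srg_hitting_time xj (negPf xj) mul0n add0n.
have c0 : cR != 0 by rewrite lt0r_neq0.
have k0 : kR != 0 by rewrite lt0r_neq0.
rewrite /= /compl_adj xj /=; case: (G x j) => /=.
  rewrite mul1n addn0 mulr0 addr0 mulr1 -/kR.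
  have -> : kR / cR * (kR - 1 - a%:R) = n - 1 - kR.
    by rewrite mulrAC param_eq mulfK.
  by field.
by rewrite mul0n mul1n !add0n -/kR -/cR !subr0; field; apply/andP.
Qed.

Lemma srg_kemeny :
  kemeny R G = (((n - 1) ^+ 2 + kR * (n - 1 - kR) / cR) / n)%:E.
Proof.
rewrite /kemeny; case: pickP => [i _|none]; last first.
  by have [x] := srg_not_complete srg; have := none x.
have edgesE : (2 * #|edges G| = #|T| * k)%N.
  by rewrite -sum_degree; under eq_bigr do rewrite deg; rewrite sum_nat_const.
rewrite /kemeny_from edgesE.
under eq_bigr do rewrite srg_mean_hitting_time deg -EFinM.
rewrite sumEFin; congr EFin.
rewrite natrM -/n -/kR -mulr_sumr /srg_hitting_time big_split -!mulr_sumr /=.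
have -> : \sum_(j | j != i) (i != j)%:R = n - 1 :> R.
  rewrite /n -sum1_card natr_sum [in RHS](bigD1 i) //= addrAC subrr add0r.
  by apply: eq_big => // j; rewrite eq_sym => ->.
have -> : \sum_(j | j != i) (compl_adj G i j)%:R = n - 1 - kR :> R.
  rewrite -(degree_complR i) degreeE natr_sum [in RHS](bigD1 i) //=.
  by rewrite {2}/compl_adj eqxx add0r.
by field; rewrite !lt0r_neq0.
Qed.

(** The lower bound comes from (n - 1)^2 >= n^2 / 4 for n >= 2, the upper one
    from c >= 1. *)
Lemma srg_kemeny_bounds :
  exists2 K : R, kemeny R G = K%:E & n / 4 <= K <= 2 * n.
Proof.
eexists; first exact: srg_kemeny.
have n2 : 2 <= n by rewrite ler_nat (srg_order_gt1 srg).
have [x _] := srg_not_complete srg.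
have l0 : 0 <= n - 1 - kR by rewrite -(degree_complR x).
have k0 : 0 <= kR := ltW kR_gt0.
have t0 : 0 <= kR * (n - 1 - kR) by rewrite mulr_ge0.
have t1 : 0 <= kR * (n - 1 - kR) / cR by rewrite divr_ge0 // ltW.
have t2 : kR * (n - 1 - kR) / cR <= n ^+ 2.
  apply: (@le_trans _ _ (kR * (n - 1 - kR))).
    by rewrite ler_pdivrMr // ler_peMr // ler1n.
  by rewrite expr2 ler_pM //; lra.
have e1 : n / 4 * n <= (n - 1) ^+ 2 by nra.
have e2 : (n - 1) ^+ 2 <= n ^+ 2 by nra.
rewrite ler_pdivlMr // ler_pdivrMr //; apply/andP; split; first lra.
by rewrite -[leRHS]mulrA -expr2; lra.
Qed.

End StronglyRegularKemeny.

(** * Asymptotics *)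

(** The lower bound is needed too: the upper limit must not be minus infinity,
    and it is not since every neighbourhood of infinity meets [S]. *)
Lemma bigO_along_bounded (R : realType) (S : set nat) (f g : nat -> \bar R)
    (l u : R) :
  infinite_set S ->
  (forall n, S n -> (l%:E <= f n / g n <= u%:E)%E) -> bigO_along S f g.
Proof.
move=> infS bnd; rewrite /bigO_along fin_numElt; apply/andP; split.
  apply: (@lt_le_trans _ _ l%:E); first exact: ltNyr.
  apply: le_ereal_inf_tmp => _ [V SV <-].
  have [n [Vn Sn]] : exists n, V n /\ S n.
    case: SV => N _ NV; apply: contrapT => none; apply: infS.
    apply: (@sub_finite_set _ _ `I_N) => // n Sn /=; rewrite ltnNge.
    by apply/negP => Nn; apply: none; exists n; split => //; apply: NV.
  apply: (@le_trans _ _ (f n / g n)%E); first by case/andP: (bnd n Sn).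
  by apply: ereal_sup_ubound; exists n.
apply: (@le_lt_trans _ _ u%:E); last exact: ltry.
apply: (@le_trans _ _ (ereal_sup [set (f n / g n)%E | n in S])).
  apply: ereal_inf_lbound; exists S => //.
  by exists 0%N.
by apply: ge_ereal_sup => _ [n Sn <-]; case/andP: (bnd n Sn).
Qed.

Theorem mainTheorem8 (R : realType) (S : set nat)
    (G : forall n : nat, sgraph 'I_n)
    (S_infinite : infinite_set S)
    (S_positive : forall n, S n -> (0 < n)%N)
    (G_connected : forall n, S n -> connected_graph (G n))
    (G_srg : forall n, S n -> strongly_regular (G n))
    (G_compl : forall n, S n -> forall m r : nat, (1 < m)%N ->
       ~ isomorphic (compl (G n)) (complete_copies m r)) :
  bigTheta_along S
    (fun n => (kemeny R (G n) * kemeny R (compl (G n)))%E)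
    (fun n => ((n%:R ^+ 2)%R%:E)%E).
Proof.
have product n : S n -> exists2 K : R,
    (kemeny R (G n) * kemeny R (compl (G n)))%E = K%:E
    & n%:R ^+ 2 / 16 <= K <= 4 * n%:R ^+ 2.
  move=> Sn; have [k [a [c srg]]] := G_srg _ Sn.
  have srg' := srg_compl srg.
  have c_gt0 := srg_connected_gt0 srg (G_connected _ Sn).
  have c'_gt0 : (0 < #|'I_n| - (2 * k.+1 - (a + 2)))%N.
    rewrite lt0n; apply/eqP => c0; have [ncomp _ deg _ _] := srg'.
    have [m m1] := disjoint_cliques deg (srg_adj_trans srg' c0) ncomp.
    exact: G_compl.
  have [K1 -> /andP[l1 u1]] := srg_kemeny_bounds R srg c_gt0.
  have [K2 -> /andP[l2 u2]] := srg_kemeny_bounds R srg' c'_gt0.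
  exists (K1 * K2) => //; move: l1 u1 l2 u2; rewrite card_ord.
  have : 0 <= n%:R :> R by [].
  by move: (n%:R : R) => N N0 l1 u1 l2 u2; apply/andP; split; nra.
have n2_gt0 n : S n -> 0 < n%:R ^+ 2 :> R.
  by move=> Sn; rewrite exprn_gt0 // ltr0n S_positive.
split.
  apply: (@bigO_along_bounded _ _ _ _ 16^-1 4) => // n Sn.
  have [K -> /andP[lo up]] := product n Sn; have N0 := n2_gt0 n Sn.
  rewrite inver gt_eqF // -EFinM !lee_fin ler_pdivlMr // ler_pdivrMr //.
  by rewrite [_^-1 * _]mulrC lo.
apply: (@bigO_along_bounded _ _ _ _ 4^-1 16) => // n Sn.
have [K -> /andP[lo up]] := product n Sn; have N0 := n2_gt0 n Sn.
have K0 : 0 < K by lra.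
rewrite inver gt_eqF // -EFinM !lee_fin ler_pdivlMr // ler_pdivrMr //.
by apply/andP; split; lra.
Qed.
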